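(* Let $L$ be a generator on a finite probability space $(\Omega,\mu)$, with associated Dirichlet form $\mathcal{E}$ (as described in the context). Let $0 \leq q \leq p \leq 2$. Assume that $p$-logSob holds with a constant $C>0$. Then $q$-logSob also holds with the same constant $C$.
   Context: Setting: $(\Omega,\mu)$ is a finite probability space with $\mu\{\omega\}>0$ for all $\omega\in\Omega$; $\mathbb{E}f=\int_\Omega f\,d\mu$; $\mathcal{H}$ is the space of real-valued functions on $\Omega$ and $\mathcal{H}_{(0,\infty)}$ the set of strictly positive functions. A generator is a linear operator $L:\mathcal{H}\to\mathcal{H}$ such that: $L1=0$; $\mathbb{E}[fLg]=\mathbb{E}[gLf]$ for all $f,g\in\mathcal{H}$; $\mathbb{E}[fLf]\ge 0$ for all $f\in\mathcal{H}$; and whenever $f\in\mathcal{H}$ and $\omega\in\Omega$ satisfy $f\le f(\omega)$ on $\Omega$, then $(Lf)(\omega)\ge 0$. The Dirichlet form is $\mathcal{E}(f,g)=\mathbb{E}[fLg]$. Write $\mathrm{Var}(f)=\mathbb{E}f^2-(\mathbb{E}f)^2$ and, for $f>0$, $Ent(f)=\mathbb{E}(f\log f)-\mathbb{E}f\cdot\log\mathbb{E}f$. Log-Sobolev inequalities: $p$-logSob is satisfied with constant $C>0$ if for every $f\in\mathcal{H}_{(0,\infty)}$: - for $p\in\mathbb{R}\setminus\{0,1\}$: $Ent(f^p)\le \frac{Cp^2}{4(p-1)}\mathcal{E}(f^{p-1},f)$; - for $p=1$: $Ent(f)\le\frac{C}{4}\mathcal{E}(f,\log f)$; - for $p=0$: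 $\mathrm{Var}(\log f)\le-\frac{C}{2}\mathcal{E}(f,1/f)$. *)

(* Defs.v *)
From HB Require Import structures.
From mathcomp Require Import all_boot all_order all_algebra.
From mathcomp Require Import reals exp.

Set Implicit Arguments.
Unset Strict Implicit.
Unset Printing Implicit Defensive.

Import Order.TTheory GRing.Theory Num.Theory.
Local Open Scope ring_scope.

(* The codomain is [R^o], the field R seen as a module over itself, so that
   this type is canonically an R-module; products and powers of functions
   below are those of the library's pointwise ring structure on it. *)
Notation Hsp R Omega := {ffun Omega -> R^o}.

Section LogSob.
Variables (R : realType) (Omega : finType).
Implicit Types (mu : Omega -> R) (f g : Hsp R Omega).

Definition full_support_prob mu : Prop :=
  (forall w, 0 < mu w) /\ \sum_w mu w = 1.

Definition expectation mu f : R := \sum_w mu w * f w.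

Definition flog f : Hsp R Omega := [ffun w => ln (f w)].
Definition fpow f (a : R) : Hsp R Omega := [ffun w => f w `^ a].
Definition finv f : Hsp R Omega := [ffun w => (f w)^-1].

Definition positive f : Prop := forall w, 0 < f w.

Definition variance mu f : R :=
  expectation mu (f ^+ 2) - expectation mu f ^+ 2.

Definition entropy mu f : R :=
  expectation mu (f * flog f) - expectation mu f * ln (expectation mu f).

Definition dirichlet mu (L : Hsp R Omega -> Hsp R Omega) f g : R :=
  expectation mu (f * L g).

Record generator mu (L : {linear Hsp R Omega -> Hsp R Omega}) : Prop :=
  Generator {
    generator_one : L 1 = 0;
    generator_sym : forall f g,
      expectation mu (f * L g) = expectation mu (g * L f);
    generator_ge0 : forall f, 0 <= expectation mu (f * L f);
    generator_max : forall f w, (forall v, f v <= f w) -> 0 <= L f w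
  }.

Definition logSob mu (L : Hsp R Omega -> Hsp R Omega) (p C : R) : Prop :=
  forall f, positive f ->
    if p == 0 then
      variance mu (flog f) <= - (C / 2) * dirichlet mu L f (finv f)
    else if p == 1 then
      entropy mu f <= C / 4 * dirichlet mu L f (flog f)
    else
      entropy mu (fpow f p) <=
        C * p ^+ 2 / (4 * (p - 1)) * dirichlet mu L (fpow f (p - 1)) f.

End LogSob.

(* Main.v *)
Require Import Defs.
From HB Require Import structures.
From mathcomp Require Import all_boot all_order all_algebra.
From mathcomp Require Import reals exp.
From mathcomp Require Import ring lra.
From mathcomp Require Import functions topology normedtype sequences derive.
From mathcomp Require Import realfun.

(** Write f = exp (h / p).  The Dirichlet form is a sum over pairs of points,
    [dirichletE], with weights that are nonnegative off the diagonal, so for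
    p > 0 the p-inequality says, for every real function h,
      Ent (exp h) <= C / 4 * (1/2) sum_(x,y) c(x,y) K_p (h x, h y),
    where the entropy no longer depends on p and
      K_p (a, b) = p^2 / (p - 1) (e^(a (p-1)/p) - e^(b (p-1)/p))
                                 (e^(a/p) - e^(b/p)),
    with the value (e^a - e^b) (a - b) in the limit p = 1
    ([logSob_energy]).  It is thus enough that K_p is nonincreasing in p on
    (0, 2], pair by pair.  With s = (a - b) / 2 and u = 2 / p - 1, the addition
    formulas give
      K_p (a, b) = 8 e^((a+b)/2) s^2 (cosh (u s) - cosh s) / ((u s)^2 - s^2),
    a multiple of the slope of the chord of the function cosh o sqrt between
    the abscissae s^2 and (u s)^2 ([logSob_kernel_chord]).  Since cosh o sqrt
    is convex ([ch_sqr_tangent], i.e. sinh x / x is nondecreasing), the slope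
    is nondecreasing in u >= 0 ([chord_ndecr]), and u decreases with p.

    The case q = 0 is the limit of the q-inequalities as q decreases to 0.  By
    homogeneity log f may be centered; put h = log f.  The q-inequality for
    exp (q h) has on the left q^2 Var(h) / 2 up to an error of order q^3
    ([entropy_exp_lower]), and on the right at most - (C / 4) q^2 E(f, 1/f), up
    to a factor 1 + O(q) ([logSob_kernel_le_inv]); dividing by q^2 and letting q
    tend to 0 gives the claim ([variance_le_zero_energy]). *)

Import Order.TTheory GRing.Theory Num.Theory.
Import numFieldNormedType.Exports.
Local Open Scope ring_scope.

(** * Convexity of cosh o sqrt *)

(** By the mean value theorem a function decreases towards a point b where its
    derivative at y has the sign of y - b; only the points y between b and
    x matter. *)
Lemma min_of_derive_sign {R : realType} (F dF : R -> R) (b x : R) :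
  (forall y : R, is_derive y 1 F (dF y)) ->
  (forall y, 0 <= (y - b) * (x - y) -> 0 <= dF y * (y - b)) ->
  F b <= F x.
Proof.
move=> derF sgn; have cF : continuous F.
  move=> y; apply/differentiable_continuous/derivable1_diffP.
  exact: (@ex_derive _ _ _ _ _ _ _ (derF y)).
have [bx|xb|->//] := ltgtP b x.
- have [|c] := @MVT _ F dF b x bx (fun y _ => derF y).
    exact: continuous_subspaceT.
  rewrite in_itv/= => /andP[bc cx] E.
  rewrite -subr_ge0 E mulr_ge0 ?subr_ge0 ?(ltW bx)//.
  rewrite -(pmulr_lge0 (x := c - b)) ?subr_gt0//; apply: sgn.
  by rewrite mulr_ge0// subr_ge0 ltW.
- have [|c] := @MVT _ F dF x b xb (fun y _ => derF y).
    exact: continuous_subspaceT.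
  rewrite in_itv/= => /andP[xc cb] E.
  rewrite -subr_le0 E mulr_le0_ge0 ?subr_ge0 ?(ltW xb)//.
  have : 0 <= dF c * (c - b).
    by apply: sgn; rewrite mulr_le0// subr_le0 ltW.
  by rewrite nmulr_lge0// subr_lt0.
Qed.

Lemma scalerE {R : realType} (a b : R) : a *: (b : R^o) = a * b.
Proof. by []. Qed.

(** Twice the hyperbolic cosine and sine: the halves would only clutter the
    addition formulas. *)
Definition ch {R : realType} (x : R) : R := expR x + expR (- x).
Definition sh {R : realType} (x : R) : R := expR x - expR (- x).

#[local] Instance is_derive_ch {R : realType} (x : R) :
  is_derive x 1 (@ch R) (sh x).
Proof.
have -> : @ch R = expR \+ (expR \o -%R) by [].
by apply: is_derive_eq; rewrite /= /sh; ring.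
Qed.

#[local] Instance is_derive_sh {R : realType} (x : R) :
  is_derive x 1 (@sh R) (ch x).
Proof.
have -> : @sh R = expR \- (expR \o -%R) by [].
by apply: is_derive_eq; rewrite /= /ch; ring.
Qed.

Lemma chN {R : realType} (x : R) : ch (- x) = ch x.
Proof. by rewrite /ch opprK addrC. Qed.

Lemma sh0 {R : realType} : sh (0 : R) = 0.
Proof. by rewrite /sh oppr0 subrr. Qed.

Lemma sh_ge0 {R : realType} (x : R) : 0 <= x -> 0 <= sh x.
Proof. by move=> x0; rewrite /sh subr_ge0 ler_expR; lra. Qed.

Lemma ler_ch {R : realType} (x y : R) : 0 <= x -> x <= y -> ch x <= ch y.
Proof.
move=> x0 xy; apply: (@min_of_derive_sign R (@ch R) (@sh R)) => z Hz.
have zx : x <= z by nra.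
by apply: mulr_ge0; [apply: sh_ge0; lra | lra].
Qed.

(** The convexity of sinh on the half-line, in the form that says that
    sinh x / x is nondecreasing. *)
Lemma sh_star {R : realType} (t x : R) :
  0 <= t -> t <= 1 -> 0 <= x -> sh (t * x) <= t * sh x.
Proof.
move=> t0 t1 x0.
pose F := (fun y => t * sh y - sh (t * y)).
pose dF := (fun y => t * (ch y - ch (t * y))).
have : F 0 <= F x.
  apply: (@min_of_derive_sign R F dF) => [y|y].
    have -> : F = ((t *: (@sh R : R -> R^o)) - (@sh R \o (t *: (id : R -> R^o)))) by [].
    by apply: is_derive_eq; rewrite /dF /= ?scalerE; ring.
  rewrite subr0 => Hy.
  have y0 : 0 <= y by nra.
  rewrite /dF !mulr_ge0// subr_ge0; apply: ler_ch; nra.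
by rewrite /F mulr0 sh0 mulr0 subrr subr_ge0.
Qed.

(** The tangent line inequality at b^2 for the convex function cosh o sqrt: as
    functions of x, the difference of the two sides has derivative
    sh x - (x / b) sh b, whose sign is that of x - b by [sh_star]. *)
Lemma ch_sqr_tangent {R : realType} (b x : R) : 0 < b -> 0 <= x ->
  sh b / (2 * b) * (x ^+ 2 - b ^+ 2) <= ch x - ch b.
Proof.
move=> b0 x0; set k := sh b / (2 * b).
pose F := (fun y => ch y - k * y ^+ 2).
pose dF := (fun y => sh y - k * (2 * y)).
have : F b <= F x.
  apply: (@min_of_derive_sign R F dF) => [y|y Hy].
    have -> : F = (@ch R - k *: (fun y => y ^+ 2 : R^o)) by [].
    by apply: is_derive_eq; rewrite /dF /= ?scalerE -mulr_natl; ring.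
  have y0 : 0 <= y by nra.
  have -> : dF y = sh y - y / b * sh b.
    by rewrite /dF /k; field; lra.
  have [yb|/ltW yb] := lerP y b.
    have := @sh_star R (y / b) b.
    rewrite divfK ?gt_eqF// ler_pdivrMr// mul1r divr_ge0// ?(ltW b0)//.
    by move=> /(_ isT yb isT) H; nra.
  have y1 : 0 < y by lra.
  have := @sh_star R (b / y) y.
  rewrite divfK ?gt_eqF// ler_pdivrMr// mul1r divr_ge0// ?(ltW b0)//.
  move=> /(_ isT yb y0) H.
  have {}H : y / b * sh b <= sh y.
    have -> : sh y = y / b * (b / y * sh y) by field; lra.
    by rewrite ler_wpM2l// divr_ge0// ltW.
  by nra.
by rewrite /F; nra.
Qed.

(** The slope of cosh o sqrt between s^2 and x^2, extended by the derivative
    when the two points coincide. *)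
Definition chord {R : realType} (s x : R) : R :=
  if x == s then sh s / (2 * s) else (ch x - ch s) / (x ^+ 2 - s ^+ 2).

(** In each relative position of x, y and s, the tangent at the middle one of
    the three points compares the two slopes. *)
Lemma chord_ndecr {R : realType} (s x y : R) :
  0 < s -> 0 <= x -> x <= y -> chord s x <= chord s y.
Proof.
move=> s0 x0; rewrite le_eqVlt => /orP[/eqP->//|xy].
have y0 : 0 < y by lra.
have Ts := @ch_sqr_tangent R s _ s0.
have Ty := @ch_sqr_tangent R y _ y0.
rewrite /chord; have [xs|sx|xs] := ltgtP x s; last first.
- subst x; rewrite gt_eqF// ler_pdivlMr; last by nra.
  exact/Ts/ltW.
- have x1 : 0 < x by lra.
  have Tx := @ch_sqr_tangent R x _ x1.
  rewrite gt_eqF; last by lra.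
  have xs2 : 0 < x ^+ 2 - s ^+ 2 by nra.
  have ys2 : 0 < y ^+ 2 - s ^+ 2 by nra.
  have yx2 : 0 < y ^+ 2 - x ^+ 2 by nra.
  set k := sh x / _ in Tx *; have Tys := Tx y (ltW y0).
  have mk : (ch x - ch s) / (x ^+ 2 - s ^+ 2) <= k.
    by rewrite ler_pdivrMr//; have := Tx s (ltW s0); lra.
  rewrite ler_pdivlMr//.
  have := divfK (lt0r_neq0 xs2) (ch x - ch s).
  set m := _ / _ in mk * => mE.
  have := ler_wpM2r (ltW yx2) mk; lra.
- have sx2 : 0 < s ^+ 2 - x ^+ 2 by nra.
  have -> : (ch x - ch s) / (x ^+ 2 - s ^+ 2)
          = (ch s - ch x) / (s ^+ 2 - x ^+ 2) by field; lra.
  have [ys|sy|ys] := ltgtP y s; last first.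
  + by subst y; rewrite ler_pdivrMr//; have := Ts x x0; lra.
  + have ys2 : 0 < y ^+ 2 - s ^+ 2 by nra.
    apply: (@le_trans _ _ (sh s / (2 * s))).
      by rewrite ler_pdivrMr//; have := Ts x x0; lra.
    by rewrite ler_pdivlMr//; exact/Ts/ltW.
  have sy2 : 0 < s ^+ 2 - y ^+ 2 by nra.
  have yx2 : 0 < y ^+ 2 - x ^+ 2 by nra.
  have -> : (ch y - ch s) / (y ^+ 2 - s ^+ 2)
          = (ch s - ch y) / (s ^+ 2 - y ^+ 2) by field; lra.
  set k := sh y / _ in Ty *; have Tyx := Ty x x0.
  have mk : k <= (ch s - ch y) / (s ^+ 2 - y ^+ 2).
    by rewrite ler_pdivlMr//; have := Ty s (ltW s0); lra.
  rewrite ler_pdivrMr//.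
  have := divfK (lt0r_neq0 sy2) (ch s - ch y).
  set m := _ / _ in mk * => mE.
  have := ler_wpM2r (ltW yx2) mk; lra.
Qed.

(** * The two-point energy and its monotonicity in the exponent *)

(** The contribution of a pair of points to the right-hand side of the
    p-inequality, when f ^ p takes there the values exp a and exp b. *)
Definition logSob_kernel {R : realType} (p a b : R) : R :=
  if p == 1 then (expR a - expR b) * (a - b)
  else p ^+ 2 / (p - 1) * (expR (a * (p - 1) / p) - expR (b * (p - 1) / p))
         * (expR (a / p) - expR (b / p)).

(** The absolute value in [`|2 / p - 1|] covers p > 2; cosh being even, it is
    harmless. *)
Lemma logSob_kernel_chord {R : realType} (p a b : R) : 0 < p -> b < a ->
  let s := (a - b) / 2 in
  logSob_kernel p a b = 4 * expR ((a + b) / 2) * s ^+ 2 * chord s (`|2 / p - 1| * s).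
Proof.
move=> p0 ba s; have s0 : 0 < s by rewrite /s; lra.
have aE : a = (a + b) / 2 + s by rewrite /s; field.
have bE : b = (a + b) / 2 - s by rewrite /s; field.
set c := (a + b) / 2 in aE bE *; clearbody s.
have -> : logSob_kernel p a b = logSob_kernel p (c + s) (c - s) by rewrite -aE -bE.
rewrite /logSob_kernel /chord; case: eqP => [->|/eqP p1].
  rewrite divr1 (_ : 2 - 1 = 1 :> R); last by ring.
  rewrite normr1 mul1r eqxx !expRD /sh; field; lra.
have sgn : `|2 / p - 1| != 1.
  rewrite eqr_norml ler01 andbT; apply/norP; split; apply/eqP => H.
    have : 2 / p = 2 by lra.
    move/(congr1 ( *%R^~ p)); rewrite divfK ?gt_eqF// => H2.
    by move/eqP: p1; lra.
  have : 2 / p = 0 by lra.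
  by apply/eqP; rewrite mulf_neq0 ?invr_eq0 ?gt_eqF.
have -> : (`|2 / p - 1| * s == s) = false.
  apply/negP => /eqP H; move/eqP: sgn; apply.
  by apply: (mulIf (lt0r_neq0 s0)); rewrite mul1r.
have -> : ch (`|2 / p - 1| * s) = ch ((2 / p - 1) * s).
  by case: (ger0P (2 / p - 1)) => // _; rewrite mulNr chN.
rewrite exprMn real_normK ?num_real//.
set u := 2 / p - 1.
have Ep : (c + s) * (p - 1) / p = (c + s) - (c + s) / p by field; lra.
have Em : (c - s) * (p - 1) / p = (c - s) - (c - s) / p by field; lra.
have E : (expR ((c + s) * (p - 1) / p) - expR ((c - s) * (p - 1) / p)) *
         (expR ((c + s) / p) - expR ((c - s) / p)) =
         expR c * (ch s - ch (u * s)).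
  rewrite Ep Em mulrBl !mulrBr -!expRD /ch !mulrDr -!expRD.
  have -> : c + s - (c + s) / p + (c + s) / p = c + s by ring.
  have -> : c - s - (c - s) / p + (c - s) / p = c - s by ring.
  have -> : c + s - (c + s) / p + (c - s) / p = c - u * s.
    by rewrite /u; field; lra.
  have -> : c - s - (c - s) / p + (c + s) / p = c + u * s.
    by rewrite /u; field; lra.
  ring.
rewrite -mulrA E.
have u2 : u ^+ 2 - 1 = - 4 * (p - 1) / p ^+ 2 by rewrite /u; field; lra.
have -> : u ^+ 2 * s ^+ 2 - s ^+ 2 = (- 4 * (p - 1) / p ^+ 2) * s ^+ 2.
  by rewrite -u2; ring.
field; rewrite (gt_eqF s0) (gt_eqF p0) /= subr_eq0 p1; lra.
Qed.

Lemma logSob_kernelC {R : realType} (p a b : R) : logSob_kernel p a b = logSob_kernel p b a.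
Proof. by rewrite /logSob_kernel; case: ifP => _; ring. Qed.

Lemma logSob_kernel_diag {R : realType} (p a : R) : logSob_kernel p a a = 0.
Proof. by rewrite /logSob_kernel; case: ifP => _; rewrite !subrr mulr0. Qed.

(** The restriction p <= 2 is used to have 0 <= 2 / p - 1 <= 2 / q - 1: the
    kernel is invariant under exchanging p with its conjugate exponent, hence
    not monotone past p = 2. *)
Lemma logSob_kernel_ninc {R : realType} (p q a b : R) :
  0 < q -> q <= p -> p <= 2 -> logSob_kernel p a b <= logSob_kernel q a b.
Proof.
move=> q0 qp p2; wlog ba : a b / b < a.
  move=> W; have [ab|ba|->] := ltgtP a b; last by rewrite !logSob_kernel_diag.
    by rewrite (logSob_kernelC p) (logSob_kernelC q); exact: W.
  exact: W.
have p0 : 0 < p by lra.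
have s0 : 0 < (a - b) / 2 by lra.
have p21 : 1 <= 2 / p by rewrite ler_pdivlMr ?mul1r.
have pq : 2 / p <= 2 / q by rewrite ler_pM2l// lef_pV2// posrE.
rewrite !logSob_kernel_chord// ler_wpM2l//.
  by apply: mulr_ge0; [apply: mulr_ge0; [lra | exact: expR_ge0]
                       | exact: sqr_ge0].
apply: chord_ndecr => //; first by rewrite mulr_ge0 ?normr_ge0// ltW.
by rewrite ler_pM2r// !ger0_norm; lra.
Qed.

(** Comparison of the kernel for a small exponent e with the one of the
    inequality for the exponent 0.  Only a crude bound is needed, as the
    factor exp (e M) / (1 - e) tends to 1: for b <= a,
      e^(eb) e^(-b) - e^(ea) e^(-a) <= e^(eb) (e^(-b) - e^(-a)). *)
Lemma logSob_kernel_le_inv {R : realType} (e M a b : R) : 0 < e -> e < 1 ->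
  a <= M -> b <= M ->
  logSob_kernel e (e * a) (e * b) <=
  e ^+ 2 / (1 - e) * expR (e * M) * - ((expR a - expR b) * (expR (- a) - expR (- b))).
Proof.
move=> e0 e1; wlog ba : a b / b <= a.
  move=> W aM bM; have [ab|/ltW ba] := lerP a b.
    rewrite logSob_kernelC -[X in _ * - X]mulrNN !opprB; exact: W.
  exact: W.
move=> aM bM; rewrite /logSob_kernel lt_eqF//.
have -> : e * a * (e - 1) / e = e * a - a by field; lra.
have -> : e * b * (e - 1) / e = e * b - b by field; lra.
rewrite [e * a / e]mulrAC [e * b / e]mulrAC divff ?gt_eqF// !mul1r.
have -> : e ^+ 2 / (e - 1) = - (e ^+ 2 / (1 - e)) by field; lra.
have x0 : 0 <= expR a - expR b by rewrite subr_ge0 ler_expR.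
have key : expR (e * b - b) - expR (e * a - a)
             <= expR (e * M) * (expR (- b) - expR (- a)).
  rewrite !expRD mulrBr.
  have bM' : expR (e * b) <= expR (e * M) by rewrite ler_expR ler_pM2l.
  have ab : expR (e * b) <= expR (e * a) by rewrite ler_expR ler_pM2l.
  have na := expR_ge0 (- a).
  have nab : expR (- a) <= expR (- b) by rewrite ler_expR lerN2.
  nra.
have k0 : 0 <= e ^+ 2 / (1 - e) by rewrite divr_ge0 ?sqr_ge0//; lra.
have := ler_wpM2r x0 (ler_wpM2l k0 key); lra.
Qed.

(** * Expansion of the entropy integrand *)

(** With t = exp x this is a lower bound for t log t - t + 1.  The cubic term
    is the next one of the Taylor expansion; it is chosen so that the
    derivative of the difference, x (exp x - 1 - x), has the sign of x. *)
Lemma xlogx_lower {R : realType} (x : R) :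
  x ^+ 2 / 2 + x ^+ 3 / 3 <= x * expR x - expR x + 1.
Proof.
pose F := (fun y : R => (y - 1) * expR y - (2^-1 * y ^+ 2 + 3^-1 * y ^+ 3)).
pose dF := (fun y : R => y * (expR y - 1 - y)).
have : F 0 <= F x.
  apply: (@min_of_derive_sign R F dF) => [y|y _].
    have -> : F = ((id - cst 1) * expR)
       - ((2^-1 *: (fun y : R => y ^+ 2 : R^o)) + (3^-1 *: (fun y => y ^+ 3 : R^o))).
      by [].
    have dexp : is_derive y 1 ((id - cst 1) * (@expR R)) (y * expR y).
      have := is_deriveM (is_deriveB (is_derive_id (y : R^o) 1) (is_derive_cst (1 : R^o) y 1)) (is_derive_expR y).
      by congr is_derive; rewrite /= !scalerE -[(_ - _) y]/(y - 1); ring.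
    have dpol : is_derive y 1 ((2^-1 *: (fun y : R => y ^+ 2 : R^o))
        + (3^-1 *: (fun y : R => y ^+ 3 : R^o))) (y + y ^+ 2).
      have dX n := is_deriveX n (is_derive_id (y : R^o) 1).
      have := is_deriveD (is_deriveZ 2^-1 (dX 2)) (is_deriveZ 3^-1 (dX 3)).
       by congr is_derive; rewrite /= !scalerE; field.
    rewrite (_ : dF y = y * expR y - (y + y ^+ 2)); last by rewrite /dF; ring.
    exact: is_deriveB.
  have := expR_ge1Dx y; rewrite subr0 /dF; nra.
rewrite /F expR0; lra.
Qed.
(** * The Dirichlet form as a sum over pairs *)

Lemma ffun_mulE {R : realType} {Omega : finType} (f g : Hsp R Omega) w :
  (f * g) w = f w * g w.
Proof. by rewrite ffunE. Qed.

Definition fexp {R : realType} {Omega : finType} (h : Omega -> R) : Hsp R Omega :=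
  [ffun w => expR (h w)].

(** The transition rate between two points, weighted by mu; off the diagonal
    it is nonnegative by the maximum principle for the generator. *)
Definition conductance {R : realType} {Omega : finType} (mu : Omega -> R)
    (L : Hsp R Omega -> Hsp R Omega) (x y : Omega) : R :=
  - (mu x * L [ffun w => (w == y)%:R] x).

Section Conductances.
Context {R : realType} {Omega : finType} (mu : Omega -> R).
Context (L : {linear Hsp R Omega -> Hsp R Omega}).
Hypotheses (mu_prob : full_support_prob mu) (L_gen : generator mu L).

Let ind y : Hsp R Omega := [ffun w => (w == y)%:R].

Let expectation_ind (f : Hsp R Omega) y : expectation mu (ind y * f) = mu y * f y.
Proof.
rewrite /expectation (bigD1 y)//= ffun_mulE ffunE eqxx mul1r big1 ?addr0// => w wy.
by rewrite ffun_mulE ffunE (negbTE wy) mul0r mulr0.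
Qed.

Let generator_ind (g : Hsp R Omega) x : L g x = \sum_y g y * L (ind y) x.
Proof.
have {1}-> : g = \sum_y g y *: ind y.
  apply/ffunP => w; rewrite sum_ffunE (bigD1 w)//= !ffunE eqxx big1.
    by rewrite addr0 scalerE mulr1.
  by move=> i iw; rewrite !ffunE eq_sym (negbTE iw) scalerE mulr0.
rewrite linear_sum sum_ffunE; apply: eq_bigr => y _.
by rewrite linearZ ffunE.
Qed.

(** Minus the indicator of y is maximal at every point x other than y. *)
Lemma conductance_ge0 x y : x != y -> 0 <= conductance mu L x y.
Proof.
move=> xy; rewrite /conductance -mulrN; apply: mulr_ge0; first exact/ltW/(mu_prob.1 x).
have -> : - L (ind y) x = L (- ind y) x by rewrite linearN [RHS]ffunE.
apply: (generator_max L_gen) => v; rewrite !ffunE (negbTE xy) oppr0.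
by case: eqP => _ /=; rewrite ?oppr0// lerN10.
Qed.

Lemma conductanceC x y : conductance mu L x y = conductance mu L y x.
Proof.
rewrite /conductance -!expectation_ind; congr (- _).
exact: generator_sym L_gen _ _.
Qed.

Lemma conductance_sum0 x : \sum_y conductance mu L x y = 0.
Proof.
rewrite /conductance sumrN -mulr_sumr.
have := generator_ind 1 x; rewrite (generator_one L_gen) ffunE => E.
rewrite (eq_bigr (fun y => (1 : Hsp R Omega) y * L (ind y) x)).
  by rewrite -E mulr0 oppr0.
by move=> y _; rewrite ffunE mul1r.
Qed.

(** In the expansion of the product the diagonal terms vanish, because the
    generator kills constants, and the two crossed terms are both equal to the
    Dirichlet form, by symmetry. *)
Lemma dirichletE f g : dirichlet mu L f g =
  2^-1 * \sum_x \sum_y conductance mu L x y * ((f x - f y) * (g x - g y)).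
Proof.
pose K := conductance mu L.
have diag (F : Omega -> R) : \sum_x \sum_y K x y * F x = 0.
  rewrite big1// => x _; rewrite -mulr_suml.
  by rewrite [X in X * _]conductance_sum0 mul0r.
have diag' (F : Omega -> R) : \sum_x \sum_y K x y * F y = 0.
  rewrite exchange_big /= -[RHS](diag F); apply: eq_bigr => x _; apply: eq_bigr => y _.
  by rewrite /K conductanceC.
have cross : dirichlet mu L f g = - \sum_x \sum_y K x y * (f x * g y).
  rewrite /dirichlet /expectation -sumrN; apply: eq_bigr => x _.
  rewrite ffun_mulE generator_ind !mulr_sumr -sumrN; apply: eq_bigr => y _.
  by rewrite /K /conductance; ring.
have cross' : dirichlet mu L f g = - \sum_x \sum_y K x y * (f y * g x).
  rewrite cross exchange_big /=; congr (- _); apply: eq_bigr => x _.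
  by apply: eq_bigr => y _; rewrite /K conductanceC.
have -> : \sum_x \sum_y K x y * ((f x - f y) * (g x - g y)) =
   \sum_x \sum_y K x y * (f x * g x) + \sum_x \sum_y K x y * (f y * g y)
   - \sum_x \sum_y K x y * (f x * g y) - \sum_x \sum_y K x y * (f y * g x).
  rewrite -big_split -!sumrB /=; apply: eq_bigr => x _.
  rewrite -big_split -!sumrB /=; apply: eq_bigr => y _; ring.
rewrite (diag (fun x => f x * g x)) (diag' (fun x => f x * g x)).
by rewrite addr0 sub0r -cross -cross'; field.
Qed.

Lemma conductance_form_le (k k' : Omega -> Omega -> R) :
  (forall x, k x x = k' x x) -> (forall x y, k x y <= k' x y) ->
  \sum_x \sum_y conductance mu L x y * k x y <=
  \sum_x \sum_y conductance mu L x y * k' x y.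
Proof.
move=> kD kk'; apply: ler_sum => x _; apply: ler_sum => y _.
have [->|xy] := eqVneq x y; first by rewrite kD.
by rewrite ler_wpM2l// conductance_ge0.
Qed.

(** * Positive exponents *)

Definition energy (p : R) (h : Omega -> R) : R :=
  2^-1 * \sum_x \sum_y conductance mu L x y * logSob_kernel p (h x) (h y).

(** The substitution f = exp (h / p) moves the whole dependence on p to the
    right-hand side. *)
Lemma logSob_energy (p C : R) : 0 < p ->
  logSob mu L p C <->
  forall h : Omega -> R,
    entropy mu (fexp h) <= C / 4 * energy p h.
Proof.
move=> p0; pose expdiv (h : Omega -> R) : Hsp R Omega := fexp (fun w => h w / p).
have core h :
  ((if p == 0 then
     variance mu (flog (expdiv h)) <=
       - (C / 2) * dirichlet mu L (expdiv h) (Defs.finv (expdiv h))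
   else if p == 1 then
     entropy mu (expdiv h) <= C / 4 * dirichlet mu L (expdiv h) (flog (expdiv h))
   else entropy mu (fpow (expdiv h) p) <=
     C * p ^+ 2 / (4 * (p - 1)) *
       dirichlet mu L (fpow (expdiv h) (p - 1)) (expdiv h)) : Prop)
  = (entropy mu (fexp h) <= C / 4 * energy p h).
  rewrite gt_eqF// /energy; case: eqP => [p1|/eqP p1].
    rewrite (_ : expdiv h = (fexp h)); last first.
      by apply/ffunP => w; rewrite !ffunE p1 divr1.
    rewrite dirichletE; congr (is_true (_ <= _ * (_ * _))).
    apply: eq_bigr => x _; apply: eq_bigr => y _.
    by rewrite /logSob_kernel p1 eqxx !ffunE ?expRK.
  have powE (r : R) : fpow (expdiv h) r = fexp (fun w => h w / p * r).
    by apply/ffunP => w; rewrite !ffunE -expRM.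
  have -> : fpow (expdiv h) p = (fexp h).
    by rewrite powE; apply/ffunP => w; rewrite !ffunE divfK ?gt_eqF.
  congr (is_true (_ <= _)); rewrite dirichletE powE.
  have p11 : p - 1 != 0 by rewrite subr_eq0.
  rewrite !mulr_sumr; apply: eq_bigr => x _.
  rewrite !mulr_sumr; apply: eq_bigr => y _.
  rewrite /logSob_kernel (negbTE p1) !ffunE.
  have pE z : h z * (p - 1) / p = h z / p * (p - 1) by rewrite mulrAC.
  by rewrite !pE; field; exact: p11.
split=> [H h | H f f0].
  by rewrite -core; apply: H => w; rewrite ffunE expR_gt0.
have := H (fun w => p * ln (f w)); rewrite -core.
rewrite (_ : expdiv _ = f)//; apply/ffunP => w; rewrite ffunE.
by rewrite mulrAC divff ?gt_eqF// mul1r lnK// posrE.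
Qed.

Lemma energy_ninc (p q : R) h :
  0 < q -> q <= p -> p <= 2 -> energy p h <= energy q h.
Proof.
move=> q0 qp p2; rewrite ler_wpM2l ?invr_ge0//; apply: conductance_form_le.
  by move=> x; rewrite !logSob_kernel_diag.
by move=> x y; exact: logSob_kernel_ninc.
Qed.

Lemma logSob_decr_pos (p q C : R) : 0 < C -> 0 < q -> q <= p -> p <= 2 ->
  logSob mu L p C -> logSob mu L q C.
Proof.
move=> C0 q0 qp p2; rewrite !logSob_energy//; last exact: lt_le_trans qp.
move=> H h; apply: le_trans (H h) _.
by apply: ler_wpM2l; [rewrite divr_ge0// ltW | exact: energy_ninc].
Qed.

(** * The exponent zero *)

(** This is - E(f, 1/f) for f = exp h. *)
Definition zero_energy (h : Omega -> R) : R :=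
  2^-1 * \sum_x \sum_y conductance mu L x y *
    - ((expR (h x) - expR (h y)) * (expR (- h x) - expR (- h y))).

Lemma zero_energy_ge0 h : 0 <= zero_energy h.
Proof.
have H : \sum_x \sum_y conductance mu L x y * 0 = 0.
  by rewrite big1// => x _; rewrite big1// => y _; rewrite mulr0.
rewrite mulr_ge0 ?invr_ge0// -[X in X <= _]H; apply: conductance_form_le => [x|x y].
  by rewrite !subrr mul0r oppr0.
rewrite oppr_ge0; have [xy|/ltW xy] := lerP (h x) (h y).
  by rewrite mulr_le0_ge0// ?subr_le0 ?subr_ge0 ler_expR ?lerN2.
by rewrite mulr_ge0_le0// ?subr_le0 ?subr_ge0 ler_expR ?lerN2.
Qed.

Lemma energy_le_zero_energy (e M : R) h : 0 < e -> e < 1 ->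
  (forall w, h w <= M) ->
  energy e (fun w => e * h w) <= e ^+ 2 / (1 - e) * expR (e * M) * zero_energy h.
Proof.
move=> e0 e1 hM; rewrite /zero_energy mulrCA ler_wpM2l ?invr_ge0//.
have -> (c : R) (K k : Omega -> Omega -> R) : c * \sum_x \sum_y K x y * k x y
    = \sum_x \sum_y K x y * (c * k x y).
  rewrite mulr_sumr; apply: eq_bigr => x _.
  by rewrite mulr_sumr; apply: eq_bigr => y _; rewrite mulrCA.
apply: conductance_form_le => [x|x y]; last exact: logSob_kernel_le_inv.
by rewrite logSob_kernel_diag !subrr mul0r oppr0 mulr0.
Qed.

(** Let m be the mean of t = exp (e h).  The entropy is the mean of
    t log t - t + 1, bounded below by [xlogx_lower], minus m log m - m + 1,
    which is at most (m - 1)^2; and m - 1 is only of order e^2 because h is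
    centered. *)
Lemma entropy_exp_lower (e M v : R) (h : Omega -> R) :
  0 < e -> e * M <= 2^-1 -> (forall w, `|h w| <= M) ->
  \sum_w mu w * h w = 0 ->
  \sum_w mu w * h w ^+ 2 = v ->
  e ^+ 2 * v / 2 - e ^+ 3 * M ^+ 3 / 3 - (2 * e ^+ 2 * v) ^+ 2
    <= entropy mu (fexp (fun w => e * h w)).
Proof.
move=> e0 eM hM h0 vE; have mu0 w := ltW (mu_prob.1 w).
set m := \sum_w mu w * expR (e * h w).
have eh w : `|e * h w| <= 2^-1.
  by rewrite normrM gtr0_norm//; apply: le_trans eM; rewrite ler_pM2l.
have m1 : 1 <= m.
  have -> : 1 = \sum_w mu w * (1 + e * h w).
    rewrite (eq_bigr (fun w => mu w + e * (mu w * h w))); last by move=> w _; ring.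
    by rewrite big_split /= -mulr_sumr h0 mulr0 addr0 mu_prob.2.
  by apply: ler_sum => w _; rewrite ler_wpM2l// expR_ge1Dx.
have m2 : m - 1 <= 2 * e ^+ 2 * v.
  have -> : m - 1 = \sum_w mu w * (expR (e * h w) - 1 - e * h w).
    rewrite (eq_bigr (fun w => mu w * expR (e * h w) - mu w - e * (mu w * h w))).
      by rewrite !sumrB -mulr_sumr h0 mulr0 subr0 mu_prob.2.
    by move=> w _; ring.
  rewrite -vE mulr_sumr; apply: ler_sum => w _; rewrite mulrCA ler_wpM2l//.
  have := eh w; set x := e * h w; rewrite ler_norml => /andP[x1 x2].
  have := expR_ge1Dx (- x); have := expR_gt0 x.
  have : expR x * expR (- x) = 1 by rewrite -expRD subrr expR0.
  rewrite -mulrA -exprMn -/x; set E := expR x; set E' := expR (- x).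
  move=> EE E0 E'x.
  have : E * (1 - x) <= 1 by rewrite -[leRHS]EE ler_wpM2l// ltW.
  nra.
have lnm : m * ln m <= (m - 1) + (m - 1) ^+ 2.
  have := @le_ln1Dx _ (m - 1); rewrite (addrC 1) subrK => H.
  have {}H : ln m <= m - 1 by apply: H; lra.
  have : m * ln m <= m * (m - 1) by rewrite ler_wpM2l//; lra.
  lra.
have msq : (m - 1) ^+ 2 <= (2 * e ^+ 2 * v) ^+ 2.
  by rewrite ler_sqr ?nnegrE//; lra.
have low : e ^+ 2 * v / 2 - e ^+ 3 * M ^+ 3 / 3 <=
    \sum_w mu w * (e * h w * expR (e * h w)) - m + 1.
  have -> : \sum_w mu w * (e * h w * expR (e * h w)) - m + 1
      = \sum_w mu w * (e * h w * expR (e * h w) - expR (e * h w) + 1).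
    rewrite [RHS](eq_bigr (fun w => mu w * (e * h w * expR (e * h w))
                                    - mu w * expR (e * h w) + mu w)).
      by rewrite big_split sumrB /= mu_prob.2.
    by move=> w _; ring.
  have -> : e ^+ 2 * v / 2 - e ^+ 3 * M ^+ 3 / 3 =
      \sum_w mu w * ((e * h w) ^+ 2 / 2 - e ^+ 3 * M ^+ 3 / 3).
    rewrite (eq_bigr (fun w => e ^+ 2 / 2 * (mu w * h w ^+ 2)
                              - mu w * (e ^+ 3 * M ^+ 3 / 3))).
      by rewrite sumrB -mulr_sumr -mulr_suml mu_prob.2 mul1r vE; ring.
    by move=> w _; ring.
  apply: ler_sum => w _; rewrite ler_wpM2l//.
  apply: le_trans (xlogx_lower (e * h w)).
  have : `|e * h w| ^+ 3 <= (e * M) ^+ 3.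
    have eM0 : `|e * h w| <= e * M by rewrite normrM gtr0_norm// ler_pM2l.
    by rewrite lerXn2r// nnegrE (le_trans _ eM0).
  have := ler_norm (- (e * h w) ^+ 3); rewrite normrN normrX exprMn.
  by rewrite (exprMn _ e M); lra.
have entE : entropy mu (fexp (fun w => e * h w)) =
    \sum_w mu w * (e * h w * expR (e * h w)) - m * ln m.
  have mE : expectation mu (fexp (fun w => e * h w)) = m.
    by apply: eq_bigr => w _; rewrite ffunE.
  rewrite /entropy mE; congr (_ - _); apply: eq_bigr => w _.
  by rewrite ffun_mulE !ffunE expRK mulrC [in RHS]mulrC [in X in X * _]mulrC.
by rewrite entE; lra.
Qed.

(** Apply the e-inequality to exp (e h), divide by e^2 and let e tend to 0; the
    constant K collects the three error terms. *)
Lemma variance_le_zero_energy (p C : R) h : 0 < C -> 0 < p ->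
  (forall q : R, 0 < q -> q <= p -> logSob mu L q C) ->
  \sum_w mu w * h w = 0 ->
  \sum_w mu w * h w ^+ 2 <= C / 2 * zero_energy h.
Proof.
move=> C0 p0 small h0; set v := \sum_w mu w * h w ^+ 2; set A := zero_energy h.
have A0 : 0 <= A := zero_energy_ge0 h.
have mu0 w := ltW (mu_prob.1 w).
have v0 : 0 <= v by apply: sumr_ge0 => w _; rewrite mulr_ge0 ?sqr_ge0.
pose M := 1 + \sum_w `|h w|.
have hM w : `|h w| <= M.
  rewrite /M (bigD1 w)//= addrCA lerDl addr_ge0// sumr_ge0//.
have M1 : 1 <= M by rewrite lerDl sumr_ge0.
pose K := M ^+ 3 / 3 + 4 * v ^+ 2 + 3 / 2 * C * A * M.
have M3 : 1 <= M ^+ 3 by rewrite exprn_ege1.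
have K0 : 0 < K.
  have M0 : 0 <= M by lra.
  have : 0 <= C * A * M by apply: mulr_ge0 => //; apply: mulr_ge0 => //; exact: ltW.
  have := sqr_ge0 v; rewrite /K; lra.
have step (e : R) : 0 < e -> e <= p -> e * M <= 2^-1 -> v / 2 <= C / 4 * A + e * K.
  move=> e0 ep eM.
  have e12 : e <= 2^-1 by apply: le_trans eM; rewrite ler_peMr// ltW.
  have e1 : e < 1 by lra.
  have low := @entropy_exp_lower e M v h e0 eM hM h0 erefl.
  have up := (logSob_energy e C e0).1 (small _ e0 ep) (fun w => e * h w).
  have en : energy e (fun w => e * h w) <= e ^+ 2 / (1 - e) * expR (e * M) * A.
    by apply: energy_le_zero_energy => // w; exact: le_trans (ler_norm _) (hM w).
  (* M >= 1 gives 1 - e >= 1 - t for t = e M <= 1/2, and then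
     1 / (1 - t)^2 <= 1 + 6 t *)
  have slop : expR (e * M) / (1 - e) <= 1 + 6 * (e * M).
    rewrite ler_pdivrMr; last lra.
    have := expR_ge1Dx (- (e * M)); have := expR_gt0 (e * M).
    have : expR (e * M) * expR (- (e * M)) = 1 by rewrite -expRD subrr expR0.
    have : e <= e * M by rewrite ler_peMr// ltW.
    move: (e * M) eM => t t2 et; set E := expR t => EE E0 E'.
    have H1 : E * (1 - t) <= 1 by rewrite -[leRHS]EE ler_wpM2l// ltW.
    apply: (@le_trans _ _ ((1 + 6 * t) * (1 - t))); last first.
      by apply: ler_wpM2l; lra.
    have t1 : 0 < 1 - t by lra.
    rewrite -(ler_pM2r t1); apply: (le_trans H1).
    have : 0 <= t * ((1 - 2 * t) * (4 - 3 * t)) by apply: mulr_ge0; nra.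
    by lra.
  have e2 : 0 < e ^+ 2 by rewrite exprn_gt0.
  have ineq : e ^+ 2 * (v / 2) <= e ^+ 2 * (C / 4 * A + e * K).
    have C4 : 0 <= C / 4 by lra.
    have := ler_wpM2l C4 en.
    have CA : 0 <= e ^+ 2 * (C / 4 * A)
      by apply: mulr_ge0; [exact: ltW | exact: mulr_ge0].
    have := ler_wpM2l CA slop.
    have e3 : e ^+ 2 * e ^+ 2 * v ^+ 2 <= e ^+ 2 * (e * v ^+ 2).
      rewrite -mulrA ler_pM2l// ler_wpM2r ?sqr_ge0// expr2 ger_pMr//; lra.
    rewrite /K; move: low up; rewrite /=; lra.
  by rewrite -(ler_pM2l e2).
have : v / 2 <= C / 4 * A.
  apply/ler_addgt0Pr => d d0.
  (* the hypotheses of [step], and e K <= d *)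
  pose e := Num.min p (Num.min (2 * M)^-1 (d / K)).
  have e0 : 0 < e by rewrite !lt_min p0 divr_gt0// invr_gt0; lra.
  apply: le_trans (step e e0 _ _) _.
  - by rewrite ge_min lexx.
  - apply: (@le_trans _ _ ((2 * M)^-1 * M)).
      by rewrite ler_wpM2r; [|lra|rewrite !ge_min lexx orbT].
    by rewrite invfM mulfVK//; lra.
  - by rewrite lerD2l -ler_pdivlMr// !ge_min lexx !orbT.
lra.
Qed.

(** Both the variance of log f and the form E(f, 1/f) are unchanged when f is
    multiplied by a constant, so log f may be assumed to have mean 0. *)
Lemma logSob_zero_of_pos (p C : R) : 0 < C -> 0 < p ->
  (forall q : R, 0 < q -> q <= p -> logSob mu L q C) -> logSob mu L 0 C.
Proof.
move=> C0 p0 small f f0; rewrite eqxx.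
pose a := \sum_w mu w * ln (f w); pose h w := ln (f w) - a.
have h0 : \sum_w mu w * h w = 0.
  rewrite (eq_bigr (fun w => mu w * ln (f w) - mu w * a)).
    by rewrite sumrB -mulr_suml mu_prob.2 mul1r subrr.
  by move=> w _; rewrite /h mulrBr.
have varE : variance mu (flog f) = \sum_w mu w * h w ^+ 2.
  rewrite /variance (_ : expectation mu (flog f) = a); last first.
    by apply: eq_bigr => w _; rewrite ffunE.
  rewrite [RHS](eq_bigr (fun w => mu w * (ln (f w)) ^+ 2 - 2 * a * (mu w * ln (f w))
                            + mu w * a ^+ 2)); last by move=> w _; rewrite /h; ring.
  rewrite big_split /= sumrB -mulr_sumr -mulr_suml mu_prob.2 mul1r -/a.
  have -> : expectation mu (flog f ^+ 2) = \sum_w mu w * ln (f w) ^+ 2.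
    by apply: eq_bigr => w _; rewrite expr2 ffun_mulE !ffunE -expr2.
  ring.
have dirE : dirichlet mu L f (Defs.finv f) = - zero_energy h.
  rewrite dirichletE /zero_energy -mulrN -sumrN; congr (_ * _).
  apply: eq_bigr => x _; rewrite -sumrN; apply: eq_bigr => y _.
  have fE w : expR (h w) = f w * expR (- a) by rewrite /h expRD lnK// posrE.
  have fVE w : expR (- h w) = (f w)^-1 * expR a.
    by rewrite /h opprB expRD expRN lnK ?posrE// mulrC.
  have aV : expR (- a) * expR a = 1 by rewrite -expRD addNr expR0.
  rewrite !fE !fVE mulrN opprK !ffunE; congr (_ * _).
  by rewrite -!mulrBl mulrACA aV mulr1.
rewrite varE dirE mulNr mulrN opprK.
exact: variance_le_zero_energy p0 small h0.
Qed.

End Conductances.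

Theorem theorem1p7 (R : realType) (Omega : finType) (mu : Omega -> R)
    (mu_prob : full_support_prob mu)
    (L : {linear Hsp R Omega -> Hsp R Omega}) (L_gen : generator mu L)
    (p q C : R) (q_ge0 : 0 <= q) (q_le_p : q <= p) (p_le2 : p <= 2)
    (C_gt0 : 0 < C) (p_logSob : logSob mu L p C) :
  logSob mu L q C.
Proof.
have [q0|q_gt0|qE] := ltgtP q 0; first by move: q0; rewrite ltNge q_ge0.
  exact: (logSob_decr_pos _ _ mu_prob L_gen _ _ _ C_gt0 q_gt0 q_le_p p_le2 p_logSob).
subst q; move: q_le_p; rewrite le_eqVlt => /orP[/eqP p0|p_gt0].
  by rewrite p0.
apply: (logSob_zero_of_pos _ _ mu_prob L_gen _ _ C_gt0 p_gt0) => r r0 rp.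
exact: (logSob_decr_pos _ _ mu_prob L_gen _ _ _ C_gt0 r0 rp p_le2 p_logSob).
Qed.
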